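(* Let $A$ be a set of actions. For every star expression $e\in\mathit{StExp}(A)$, the entry/body-labeling $\widehat{\underline{\mathcal{C}}(e)}$ of the $1$-chart interpretation $\underline{\mathcal{C}}(e)$ is a LLEE-witness of $\underline{\mathcal{C}}(e)$. Hence the $1$-chart interpretation $\underline{\mathcal{C}}(e)$ of every star expression $e\in\mathit{StExp}(A)$ satisfies the property LEE.
   Context: **Star expressions.** For a set $A$ of actions, the set $\mathit{StExp}(A)$ of star expressions is given by the grammar $e ::= 0 \mid 1 \mid a \mid e_1+e_2 \mid e_1\cdot e_2 \mid e^{*}$ (with $a\in A$). The star height is $|0|_*=|1|_*=|a|_*=0$, $|e_1+e_2|_*=|e_1\cdot e_2|_*=\max\{|e_1|_*,|e_2|_*\}$, $|e^*|_*=1+|e|_*$. **LTSs.** An LTS (with termination) is a tuple $\langle S,A,\to,\downarrow\rangle$ with $S$ a nonempty set of states, $\to\,\subseteq S\times A\times S$, and $\downarrow\,\subseteq S$ the set of immediately terminating states. A chart is an LTS with finite state set (vertices) and a start vertex. A $1$-LTS over $A$ is an LTS with labels in $\underline A=A\cup\{1\}$, where the label $1\notin A$ is the empty-step label; a $1$-chart is a $1$-LTS with a start vertex. All notions below for LTSs and charts are applied to $1$-LTSs and $1$-charts by viewing them as LTSs with label set $\underline A$. **Stacked star expressions.** $\mathit{StExp}^{( * )}(A)$ is given by $E ::= e \mid E\cdot e \mid E\ast e^{*}$ with $e\in\mathit{StExp}(A)$, where $\ast$ is a new binary symbol (stacked product), and $E\cdot e$ for a star expression $E$ is the ordinary star expression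 product. **Variant semantics $\underline{\mathcal{T}}^{( * )}(A)$.** $a$ ranges over $A$, $\underline a$ over $\underline A$; lower-case $e$'s are star expressions, capital $E$'s stacked star expressions. Rules: $1{\downarrow}$; $e_i{\downarrow}\Rightarrow(e_1+e_2){\downarrow}$; $e_1{\downarrow},e_2{\downarrow}\Rightarrow(e_1\cdot e_2){\downarrow}$; $(e^* ){\downarrow}$; $a\xrightarrow{a}1$; $e_i\xrightarrow{a}E_i'\Rightarrow e_1+e_2\xrightarrow{a}E_i'$; $E_1\xrightarrow{\underline a}E_1'\Rightarrow E_1\cdot e_2\xrightarrow{\underline a}E_1'\cdot e_2$; $e_1{\downarrow},\,e_2\xrightarrow{a}E_2'\Rightarrow e_1\cdot e_2\xrightarrow{a}E_2'$; $e\xrightarrow{a}E'\Rightarrow e^*\xrightarrow{a}E'\ast e^*$; $E_1\xrightarrow{\underline a}E_1'\Rightarrow E_1\ast e_2^*\xrightarrow{\underline a}E_1'\ast e_2^*$; $e_1{\downarrow}\Rightarrow e_1\ast e_2^*\xrightarrow{1}e_2^*$. This defines the $1$-LTS $\underline{\mathcal{L}}(\mathit{StExp}^{( * )}(A))$. The $1$-chart interpretation $\underline{\mathcal{C}}(e)$ of a star expression $e$ is its part reachable from $e$, with start vertex $e$. **Normed$^+$.** Write $E\xrightarrow{(a]}E'$ if $E$ reaches, by finitely many (possibly zero) $1$-transitions, some $\tilde E$ with $\tilde E\xrightarrow{a}E'$, $a\in A$; write $E{\downarrow^{(1)}}$ if $E$ reaches by finitely many (possibly zero) $1$-transitions some $\tilde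 E$ with $\tilde E{\downarrow}$. $E$ is normed$^+$ if there is a path of at least one $\xrightarrow{(\cdot]}$ step from $E$ to some $E'$ with $E'{\downarrow^{(1)}}$. **Labeled semantics $\underline{\widehat{\mathcal{T}}}^{( * )}(A)$.** Transitions additionally carry a marking label $l\in\{\mathrm{bo}\}\cup\{[n]: n\ge1\}$ (written as a subscript; $\mathrm{bo}$ stands for the number $0$ and $[n]$ for $n$). The termination rules are: $1{\downarrow}$; $e_i{\downarrow}\Rightarrow(e_1+e_2){\downarrow}$; $e_1{\downarrow},e_2{\downarrow}\Rightarrow(e_1\cdot e_2){\downarrow}$; $(e^* ){\downarrow}$; and the transition rules are: $a\xrightarrow{a}_{\mathrm{bo}}1$; $e_i\xrightarrow{a}_{l}E_i'\Rightarrow e_1+e_2\xrightarrow{a}_{\mathrm{bo}}E_i'$; $E_1\xrightarrow{\underline a}_{l}E_1'\Rightarrow E_1\cdot e_2\xrightarrow{\underline a}_{l}E_1'\cdot e_2$; $e_1{\downarrow},\,e_2\xrightarrow{a}_{l}E_2'\Rightarrow e_1\cdot e_2\xrightarrow{a}_{\mathrm{bo}}E_2'$; $e\xrightarrow{a}_{l}E'\Rightarrow e^*\xrightarrow{a}_{[|e^*|_*]}E'\ast e^*$ if $e$ is normed$^+$; $e\xrightarrow{a}_{l}E'\Rightarrow e^*\xrightarrow{a}_{\mathrm{bo}}E'\ast e^*$ if $e$ is not normed$^+$; $E_1\xrightarrow{\underline a}_{l}E_1'\Rightarrow E_1\ast e_2^*\xrightarrow{\underline a}_{l}E_1'\ast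 e_2^*$; $e_1{\downarrow}\Rightarrow e_1\ast e_2^*\xrightarrow{1}_{\mathrm{bo}}e_2^*$. This defines the labeled system $\underline{\widehat{\mathcal{L}}}(\mathit{StExp}^{( * )}(A))$; $\widehat{\underline{\mathcal{C}}(e)}$ is its part reachable from $e$, with start vertex $e$. **Loop charts.** A loop chart is a chart such that: (L1) there is an infinite path from the start vertex; (L2) every infinite path from the start vertex returns to it after a positive number of transitions; (L3) only the start vertex may terminate immediately. **Entry/body-labelings.** An entry/body-labeling of an LTS (or chart) $\mathcal L$ is obtained by adding to the action label of each transition a marking label in $\mathbb{N}$. Transitions with marking label $0$ are body transitions ($\to_{\mathrm{bo}}$), those with marking label $n\ge1$ are entry transitions ($\to_{[n]}$). For a state $v$ from which a $\to_{[n]}$ transition departs, $\mathcal{C}_{\widehat{\mathcal L}}(v,n)$ is the subchart of $\mathcal L$ with start vertex $v$ consisting of the vertices and transitions on paths that start with a $\to_{[n]}$ transition from $v$, continue with body transitions only, and halt immediately if $v$ is revisited (terminating vertices inherited from $\mathcal L$). **LLEE-witness.** An entry/body-labeling $\widehat{\mathcal L}$ of $\mathcal L$ is a LLEE-witness of $\mathcal L$ if: (W1) there is no infinite path of body transitions; (W2) for every $(s,n)$, $n\ge1$, such that a $\to_{[n]}$ transition departs from $s$, $\mathcal{C}_{\widehat{\mathcal L}}(s,n)$ is a loop chart; (W3) for every such $(s,n)$, if an entry transition $t\to_{[m]}t'$ departs from a state $t\ne s$ of $\mathcal{C}_{\widehat{\mathcal L}}(s,n)$, then $m<n$. **LEE.**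 A loop subchart of a chart $\mathcal C$ is a loop chart that is the subchart of $\mathcal C$ with start vertex $v$ generated, for some vertex $v$ and some nonempty set $U$ of transitions from $v$, by all paths that start with a transition in $U$ and continue onward until $v$ is reached again (terminating vertices inherited). Eliminating it from $\mathcal C$ means removing all transitions in $U$, and then all vertices and transitions that become unreachable from the start vertex of $\mathcal C$. $\mathcal C$ satisfies LEE if repeated elimination of loop subcharts, started on $\mathcal C$, can result (after finitely many steps) in a chart without an infinite path. *)

(* Defs.v *)
From Stdlib Require Import List Arith Relations.

Set Implicit Arguments.
Unset Strict Implicit.

(* The state set is a subset of an ambient type [S], so that subcharts of a
   chart live over the same type as the chart itself. *)
Record lts (S L : Type) : Type := Lts {
  states : S -> Prop;
  trans : S -> L -> S -> Prop;
  term : S -> Prop;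
  states_nonempty : exists s, states s;
  trans_src : forall s a t, trans s a t -> states s;
  trans_tgt : forall s a t, trans s a t -> states t;
  term_states : forall s, term s -> states s
}.

Record rooted (S L : Type) : Type := Rooted {
  rooted_lts :> lts S L;
  start : S;
  start_states : states rooted_lts start
}.

(* A chart is a finite LTS with a start vertex. *)
Definition is_chart S L (C : rooted S L) : Prop :=
  exists l : list S, forall s, states C s -> In s l.

Definition edge S L (M : lts S L) (s t : S) : Prop := exists a, trans M s a t.

Definition infinite_path S (R : S -> S -> Prop) (p : nat -> S) : Prop :=
  forall i, R (p i) (p (i + 1)).

Section ReachablePart.
Variables (S L : Type) (R : S -> L -> S -> Prop) (T : S -> Prop) (s0 : S).

Definition reach (t : S) : Prop :=
  clos_refl_trans S (fun x y => exists a, R x a y) s0 t.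

Lemma reach_nonempty : exists s, reach s.
Proof. exists s0; apply rt_refl. Qed.

Lemma reach_tgt s a t : reach s /\ R s a t -> reach t.
Proof.
intros [Hs Hst]; apply rt_trans with s; [exact Hs | apply rt_step; exists a; exact Hst].
Qed.

Definition reachable_part : rooted S L :=
  @Rooted S L
    (@Lts S L reach (fun s a t => reach s /\ R s a t) (fun s => reach s /\ T s)
       reach_nonempty (fun s a t H => proj1 H) reach_tgt (fun s H => proj1 H))
    s0 (rt_refl _ _ s0).
End ReachablePart.

(* The vertices and transitions on the paths that start with a transition
   [v -a-> t] such that [U a t], continue with transitions in [B], and halt as
   soon as [v] is reached again. *)
Section Generated.
Variables (S L : Type) (T : S -> Prop) (v : S).
Variables (U : L -> S -> Prop) (B : S -> L -> S -> Prop).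

Inductive on_path : S -> Prop :=
| on_path_first a t : U a t -> on_path t
| on_path_next s a t : on_path s -> s <> v -> B s a t -> on_path t.

Definition gen_states (s : S) : Prop := s = v \/ on_path s.

Definition gen_trans (s : S) (a : L) (t : S) : Prop :=
  (s = v /\ U a t) \/ (on_path s /\ s <> v /\ B s a t).

Lemma gen_nonempty : exists s, gen_states s.
Proof. exists v; left; reflexivity. Qed.

Lemma gen_src s a t : gen_trans s a t -> gen_states s.
Proof. intros [[H _] | [H _]]; [left | right]; exact H. Qed.

Lemma gen_tgt s a t : gen_trans s a t -> gen_states t.
Proof.
intros [[_ H] | [H1 [H2 H3]]]; right.
- exact (on_path_first H).
- exact (on_path_next H1 H2 H3).
Qed.

Definition generated : rooted S L :=
  @Rooted S L
    (@Lts S L gen_states gen_trans (fun s => gen_states s /\ T s)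
       gen_nonempty gen_src gen_tgt (fun s H => proj1 H))
    v (or_introl eq_refl).
End Generated.

Definition loop_chart S L (C : rooted S L) : Prop :=
  is_chart C /\
  (exists p, p 0 = start C /\ infinite_path (edge C) p) /\
  (forall p, p 0 = start C -> infinite_path (edge C) p ->
              exists i, 0 < i /\ p i = start C) /\
  (forall s, term C s -> s = start C).

(* Marking label 0 is "body", marking label n >= 1 is "entry [n]". *)
Definition eb_labeling S L (Mh : lts S (L * nat)) (M : lts S L) : Prop :=
  (forall s, states Mh s <-> states M s) /\
  (forall s, term Mh s <-> term M s) /\
  (forall s a n t, trans Mh s (a, n) t -> trans M s a t) /\
  (forall s a t, trans M s a t -> exists! n, trans Mh s (a, n) t).

Definition departs S L (Mh : lts S (L * nat)) (s : S) (n : nat) : Prop :=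
  exists a t, trans Mh s (a, n) t.

Definition entry_subchart S L (Mh : lts S (L * nat)) (v : S) (n : nat) : rooted S L :=
  generated (term Mh) v
    (fun a t => trans Mh v (a, n) t) (fun s a t => trans Mh s (a, 0) t).

Definition LLEE_witness S L (Mh : lts S (L * nat)) (M : lts S L) : Prop :=
  eb_labeling Mh M /\
  (~ exists p, infinite_path (fun s t => exists a, trans Mh s (a, 0) t) p) /\
  (forall s n, 1 <= n -> departs Mh s n -> loop_chart (entry_subchart Mh s n)) /\
  (forall s n, 1 <= n -> departs Mh s n ->
              forall t m, states (entry_subchart Mh s n) t -> t <> s ->
                1 <= m -> departs Mh t m -> m < n).

Definition chart_LLEE_witness S L (Ch : rooted S (L * nat)) (C : rooted S L) : Prop :=
  start Ch = start C /\ LLEE_witness Ch C.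

Definition subchart_from S L (C : rooted S L) (v : S) (U : L -> S -> Prop) : rooted S L :=
  generated (term C) v U (trans C).

Definition loop_subchart S L (C : rooted S L) (v : S) (U : L -> S -> Prop) : Prop :=
  (exists a t, U a t) /\
  (forall a t, U a t -> trans C v a t) /\
  loop_chart (subchart_from C v U).

Definition eliminate S L (C : rooted S L) (v : S) (U : L -> S -> Prop) : rooted S L :=
  reachable_part (fun s a t => trans C s a t /\ ~ (s = v /\ U a t)) (term C) (start C).

Definition elim_step S L (C C' : rooted S L) : Prop :=
  exists v U, loop_subchart C v U /\ C' = eliminate C v U.

Definition LEE S L (C : rooted S L) : Prop :=
  is_chart C /\
  exists C', clos_refl_trans (rooted S L) (@elim_step S L) C C' /\
             ~ exists p, infinite_path (edge C') p.

Inductive stexp (A : Type) : Type :=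
| Zero | One | Act (a : A)
| Plus (e1 e2 : stexp A) | Prod (e1 e2 : stexp A) | Star (e : stexp A).
Arguments Zero {A}.
Arguments One {A}.

Fixpoint star_height A (e : stexp A) : nat :=
  match e with
  | Zero | One | Act _ => 0
  | Plus e1 e2 | Prod e1 e2 => Nat.max (star_height e1) (star_height e2)
  | Star e => 1 + star_height e
  end.

(* Unambiguous form of the grammar E ::= e | E . e | E * e^* : a stacked star
   expression is a star expression, or it contains a stacked product.
   [Stack E e] is E * e^* (the argument is the body e of the iteration). *)
Inductive sstexp (A : Type) : Type :=
| Ord (e : stexp A)
| Proper (P : pstexp A)
with pstexp (A : Type) : Type :=
| Stack (E : sstexp A) (e : stexp A)
| PProd (P : pstexp A) (e : stexp A).

Coercion Ord : stexp >-> sstexp.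

(* E . e, which is the ordinary product when E is a star expression. *)
Definition sprod A (E : sstexp A) (e : stexp A) : sstexp A :=
  match E with
  | Ord e0 => Ord (Prod e0 e)
  | Proper P => Proper (PProd P e)
  end.

Definition stack A (E : sstexp A) (e : stexp A) : sstexp A := Proper (Stack E e).

Inductive terminates A : sstexp A -> Prop :=
| term_one : terminates (Ord One)
| term_plus_l (e1 e2 : stexp A) : terminates e1 -> terminates (Plus e1 e2)
| term_plus_r (e1 e2 : stexp A) : terminates e2 -> terminates (Plus e1 e2)
| term_prod (e1 e2 : stexp A) : terminates e1 -> terminates e2 -> terminates (Prod e1 e2)
| term_star (e : stexp A) : terminates (Star e).

(* [Some a] is the proper action a, [None] is the empty-step label 1. *)
Inductive step A : sstexp A -> option A -> sstexp A -> Prop :=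
| step_act (a : A) : step (Act a) (Some a) (Ord One)
| step_plus_l (e1 e2 : stexp A) a E' :
    step e1 (Some a) E' -> step (Plus e1 e2) (Some a) E'
| step_plus_r (e1 e2 : stexp A) a E' :
    step e2 (Some a) E' -> step (Plus e1 e2) (Some a) E'
| step_prod_l (E1 : sstexp A) (e2 : stexp A) x E1' :
    step E1 x E1' -> step (sprod E1 e2) x (sprod E1' e2)
| step_prod_r (e1 e2 : stexp A) a E2' :
    terminates e1 -> step e2 (Some a) E2' -> step (Prod e1 e2) (Some a) E2'
| step_star (e : stexp A) a E' :
    step e (Some a) E' -> step (Star e) (Some a) (stack E' e)
| step_stack (E1 : sstexp A) (e2 : stexp A) x E1' :
    step E1 x E1' -> step (stack E1 e2) x (stack E1' e2)
| step_back (e1 e2 : stexp A) :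
    terminates e1 -> step (stack e1 e2) None (Star e2).

Definition one_steps A : sstexp A -> sstexp A -> Prop :=
  clos_refl_trans (sstexp A) (fun E E' => step E None E').

Definition induced_step A (E : sstexp A) (a : A) (E' : sstexp A) : Prop :=
  exists Et, one_steps E Et /\ step Et (Some a) E'.

Definition terminates1 A (E : sstexp A) : Prop :=
  exists Et, one_steps E Et /\ terminates Et.

Definition normed_plus A (E : sstexp A) : Prop :=
  exists E', clos_trans (sstexp A) (fun F F' => exists a, induced_step F a F') E E' /\
             terminates1 E'.

Inductive hstep A : sstexp A -> option A * nat -> sstexp A -> Prop :=
| hstep_act (a : A) : hstep (Act a) (Some a, 0) (Ord One)
| hstep_plus_l (e1 e2 : stexp A) a l E' :
    hstep e1 (Some a, l) E' -> hstep (Plus e1 e2) (Some a, 0) E'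
| hstep_plus_r (e1 e2 : stexp A) a l E' :
    hstep e2 (Some a, l) E' -> hstep (Plus e1 e2) (Some a, 0) E'
| hstep_prod_l (E1 : sstexp A) (e2 : stexp A) x l E1' :
    hstep E1 (x, l) E1' -> hstep (sprod E1 e2) (x, l) (sprod E1' e2)
| hstep_prod_r (e1 e2 : stexp A) a l E2' :
    terminates e1 -> hstep e2 (Some a, l) E2' -> hstep (Prod e1 e2) (Some a, 0) E2'
| hstep_star_entry (e : stexp A) a l E' :
    hstep e (Some a, l) E' -> normed_plus e ->
    hstep (Star e) (Some a, star_height (Star e)) (stack E' e)
| hstep_star_body (e : stexp A) a l E' :
    hstep e (Some a, l) E' -> ~ normed_plus e ->
    hstep (Star e) (Some a, 0) (stack E' e)
| hstep_stack (E1 : sstexp A) (e2 : stexp A) x l E1' :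
    hstep E1 (x, l) E1' -> hstep (stack E1 e2) (x, l) (stack E1' e2)
| hstep_back (e1 e2 : stexp A) :
    terminates e1 -> hstep (stack e1 e2) (None, 0) (Star e2).

Definition one_chart_interp A (e : stexp A) : rooted (sstexp A) (option A) :=
  reachable_part (@step A) (@terminates A) (Ord e).

Definition labeled_one_chart_interp A (e : stexp A) : rooted (sstexp A) (option A * nat) :=
  reachable_part (@hstep A) (@terminates A) (Ord e).

(* Main.v *)
(** The labels of [hstep] only ever survive below product and stack contexts, so
    an entry transition departs from a state [fill K (Star e)] with [e] normed,
    and the subchart it generates lives in the states [fill K (stack F e)], where
    [F] is a derivative of [e]: these do not terminate, and their own entry
    labels are bounded by the star height of [e].  Body transitions terminate
    because an iteration whose unfolding is a body transition can never be
    re-entered.  Conversely, whatever can terminate can do so along body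
    transitions only, which yields the return path required of a loop chart.

    LEE follows by eliminating the entry transitions by increasing label: once
    all smaller labels are gone, the subchart generated in the current chart by
    the [n]-entries of [s] consists of body transitions only, and hence coincides
    with the loop chart that the witness provides. *)
Require Import Defs.
From Stdlib Require Import List Arith Lia Relations Classical ClassicalEpsilon.

Set Implicit Arguments.
Unset Strict Implicit.

(** * Infinite paths and invariance of loop charts *)

Lemma infinite_path_exists S (R : S -> S -> Prop) (Q : S -> Prop) (x : S) :
  (forall s, Q s -> exists t, Q t /\ R s t) -> Q x ->
  exists p, p 0 = x /\ infinite_path R p.
Proof.
intros HQ Hx.
(* Dependent choice: indefinite description turns [HQ] into a successor function on the subtype of
   [Q], which is then iterated. *)
assert (next : forall s : {s | Q s}, {t : {t | Q t} | R (proj1_sig s) (proj1_sig t)}).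
{ intros [s Hs]; apply constructive_indefinite_description.
  destruct (HQ s Hs) as [t [Ht Hst]]; exists (exist _ t Ht); exact Hst. }
exists (fun i => proj1_sig (Nat.iter i (fun s => proj1_sig (next s)) (exist _ x Hx))).
split; [reflexivity |].
intros i; rewrite Nat.add_1_r; simpl.
exact (proj2_sig (next _)).
Qed.

Lemma Acc_no_infinite_path S (R : S -> S -> Prop) (x : S) :
  Acc (fun t s => R s t) x -> forall p, p 0 = x -> ~ infinite_path R p.
Proof.
induction 1 as [x _ IH]; intros p Hp Hinf.
apply (IH (p 1)) with (p := fun i => p (i + 1)).
- rewrite <- Hp; exact (Hinf 0).
- reflexivity.
- intros i; exact (Hinf (i + 1)).
Qed.

(** (L1) and (L2) depend only on the start vertex and the edges, while finiteness and (L3) pass to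
    smaller sets; so states and termination need to be compared in one direction only. *)
Lemma loop_chart_transfer S L (C D : rooted S L) :
  start D = start C ->
  (forall s, states D s -> states C s) ->
  (forall s a t, trans D s a t <-> trans C s a t) ->
  (forall s, term D s -> term C s) ->
  loop_chart C -> loop_chart D.
Proof.
intros Hst Hs Ht Htm [[l Hl] [[p [Hp0 Hp]] [HL2 HL3]]].
assert (He : forall s t, edge D s t <-> edge C s t).
{ intros s t; split; intros [a Ha]; exists a; apply Ht; exact Ha. }
rewrite <- Hst in *.
split; [exists l; auto |]; split; [| split].
- exists p; split; [congruence |]; intros i; apply He, Hp.
- intros q Hq0 Hq; apply HL2; [congruence |]; intros i; apply He, Hq.
- auto.
Qed.

(** * From a LLEE-witness to LEE *)

Section WitnessToLEE.
Variables (S L : Type) (Mh : rooted S (L * nat)) (C0 : rooted S L).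
Hypothesis witness : chart_LLEE_witness Mh C0.

(* [R s n] says that the [n]-entry transitions of [s] are still present. *)
Definition residual (C : rooted S L) (R : S -> nat -> Prop) : Prop :=
  (forall s a t, trans C s a t -> exists n, trans Mh s (a, n) t /\ (n = 0 \/ R s n)) /\
  (forall s a n t, trans Mh s (a, n) t -> n = 0 \/ R s n -> states C s -> trans C s a t) /\
  (forall s, term C s -> term Mh s) /\
  (forall s n, R s n -> states C0 s).

Lemma residual_init : residual C0 (fun s n => 1 <= n /\ states C0 s).
Proof.
destruct witness as [_ [[Hs [Ht [H1 H2]]] _]].
split; [| split; [| split]].
- intros s a t H; destruct (H2 _ _ _ H) as [n [Hn _]]; exists n; split; [exact Hn |].
  destruct n; [left; reflexivity | right; split; [lia | exact (trans_src H)]].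
- intros s a n t H _ _; exact (H1 _ _ _ _ H).
- intros s H; apply Ht, H.
- tauto.
Qed.

(** By (W3), an entry transition inside the subchart that departs away from [s] has a label below
    [n]; since [n] is minimal in [R], it is no longer present. Hence paths in [C] and paths along
    body transitions generate the same chart, and (W2) applies. *)
Lemma residual_loop_subchart C (R : S -> nat -> Prop) s n :
  residual C R -> 1 <= n -> (forall t m, R t m -> n <= m) ->
  R s n -> states C s -> departs Mh s n ->
  loop_subchart C s (fun a t => trans Mh s (a, n) t).
Proof.
intros [HC1 [HC2 [HC3 HC4]]] Hn Hmin HR Hs Hd.
destruct witness as [_ [_ [_ [W2 W3]]]].
assert (HU : forall a t, trans Mh s (a, n) t -> trans C s a t) by eauto.
split; [exact Hd |]; split; [exact HU |].
assert (Hbody : forall t a t', gen_states s (fun a t => trans Mh s (a, n) t)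
    (fun x a y => trans Mh x (a, 0) y) t -> t <> s -> trans C t a t' -> trans Mh t (a, 0) t').
{ intros t a t' Ht Hts Htr.
  destruct (HC1 _ _ _ Htr) as [m [Hm [-> | HRm]]]; [exact Hm |].
  exfalso; pose proof (Hmin _ _ HRm).
  assert (m < n); [| lia].
  apply (W3 s n Hn Hd t m Ht Hts); [lia |]; exists a, t'; exact Hm. }
assert (HCM : forall t, on_path s (fun a t => trans Mh s (a, n) t) (trans C) t ->
    on_path s (fun a t => trans Mh s (a, n) t) (fun x a y => trans Mh x (a, 0) y) t).
{ induction 1 as [a t H | t a t' _ IH Hts H].
  - apply on_path_first with a; exact H.
  - apply (on_path_next IH Hts (a := a)), Hbody; [right; exact IH | exact Hts | exact H]. }
assert (HMC : forall t,
    on_path s (fun a t => trans Mh s (a, n) t) (fun x a y => trans Mh x (a, 0) y) t ->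
    on_path s (fun a t => trans Mh s (a, n) t) (trans C) t /\ states C t).
{ induction 1 as [a t H | t a t' _ [IH IH'] Hts H].
  - split; [apply on_path_first with a; exact H | exact (trans_tgt (HU _ _ H))].
  - assert (Htr : trans C t a t') by eauto.
    split; [exact (on_path_next IH Hts Htr) | exact (trans_tgt Htr)]. }
assert (Hstates : forall t, gen_states s (fun a t => trans Mh s (a, n) t) (trans C) t ->
    gen_states s (fun a t => trans Mh s (a, n) t) (fun x a y => trans Mh x (a, 0) y) t).
{ intros t [Ht | Ht]; [left; exact Ht | right; exact (HCM t Ht)]. }
refine (loop_chart_transfer _ _ _ _ (W2 s n Hn Hd)); simpl.
- reflexivity.
- exact Hstates.
- intros t a t'; split; (intros [H | [H1 [H2 H3]]]; [left; exact H | right]).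
  + split; [exact (HCM t H1) |]; split; [exact H2 |].
    apply Hbody; [right; exact (HCM t H1) | exact H2 | exact H3].
  + destruct (HMC t H1) as [H4 H5]; split; [exact H4 |]; split; [exact H2 |].
    eauto.
- intros t [H1 H2]; split; [exact (Hstates t H1) | exact (HC3 t H2)].
Qed.

Lemma residual_eliminate C (R : S -> nat -> Prop) s n :
  residual C R -> 1 <= n ->
  residual (eliminate C s (fun a t => trans Mh s (a, n) t))
    (fun t m => R t m /\ ~ (t = s /\ m = n)).
Proof.
intros [HC1 [HC2 [HC3 HC4]]] Hn.
destruct witness as [_ [[_ [_ [HM1 HM2]]] _]].
split; [| split; [| split]]; simpl.
- intros t a t' [_ [Ht HnU]].
  destruct (HC1 _ _ _ Ht) as [m [Hm Hm']]; exists m; split; [exact Hm |].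
  destruct Hm' as [Hm' | Hm']; [left; exact Hm' |].
  right; split; [exact Hm' |]; intros [-> ->]; apply HnU; split; [reflexivity | exact Hm].
- intros t a m t' Ht Hm Hreach.
  assert (HCt : states C t).
  { apply clos_rt_rtn1 in Hreach; destruct Hreach as [| u w [b [Hb _]] _].
    - apply start_states.
    - exact (trans_tgt Hb). }
  split; [exact Hreach |]; split.
  + apply (HC2 t a m t' Ht); tauto.
  + intros [-> HU].
    (* Marking labels are unique per transition, so a removed transition has label exactly [n],
       which [Hm] excludes. *)
    destruct (HM2 _ _ _ (HM1 _ _ _ _ Ht)) as [k [_ Hk]].
    assert (m = n) by (rewrite <- (Hk m Ht); exact (Hk n HU)).
    destruct Hm as [Hm | [_ Hm]]; [lia | tauto].
- intros t [_ Ht]; exact (HC3 t Ht).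
- intros t m [Ht _]; exact (HC4 t m Ht).
Qed.

(** The list covers the states whose [n]-entries may still be present. Its head is either eliminated
    by a genuine step, or is no longer a source of [n]-entries in the chart; then the chart stays
    and only the bookkeeping [R] shrinks. *)
Lemma eliminate_level n (l : list S) : 1 <= n ->
  forall C (R : S -> nat -> Prop), residual C R ->
  (forall s m, R s m -> n < m \/ (m = n /\ In s l)) ->
  exists C' R', clos_refl_trans _ (@elim_step S L) C C' /\ residual C' R' /\
    forall s m, R' s m -> n < m.
Proof.
intros Hn; induction l as [| s l IH]; intros C R HC HR.
- exists C, R; split; [apply rt_refl |]; split; [exact HC |].
  intros s m H; destruct (HR s m H) as [H' | [_ []]]; exact H'.
- assert (HR' : forall t m, R t m /\ ~ (t = s /\ m = n) -> n < m \/ (m = n /\ In t l)).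
  { intros t m [H Hne]; destruct (HR t m H) as [H' | [-> [-> | H']]]; tauto. }
  destruct (classic (R s n /\ states C s /\ departs Mh s n)) as [[H1 [H2 H3]] | Hno].
  + destruct (IH _ _ (residual_eliminate s HC Hn) HR') as [C' [R' [Hel HC']]].
    exists C', R'; split; [| exact HC'].
    apply rt_trans with (2 := Hel); apply rt_step.
    exists s, (fun a t => trans Mh s (a, n) t); split; [| reflexivity].
    apply (residual_loop_subchart HC); auto.
    intros t m H; destruct (HR t m H) as [H' | [H' _]]; lia.
  + apply IH with (R := fun t m => R t m /\ ~ (t = s /\ m = n)); [| exact HR'].
    destruct HC as [HC1 [HC2 [HC3 HC4]]]; split; [| split; [| split]].
    * intros t a t' Ht; destruct (HC1 _ _ _ Ht) as [m [Hm Hm']].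
      exists m; split; [exact Hm |].
      destruct Hm' as [Hm' | Hm']; [left; exact Hm' |].
      right; split; [exact Hm' |]; intros [-> ->]; apply Hno.
      split; [exact Hm' |]; split; [exact (trans_src Ht) | exists a, t'; exact Hm].
    * intros t a m t' Ht Hm; apply (HC2 t a m t' Ht); tauto.
    * exact HC3.
    * intros t m [Ht _]; exact (HC4 t m Ht).
Qed.

(* The bound is not automatic: a chart may have infinitely many transitions. *)
Lemma LLEE_witness_LEE N : is_chart C0 ->
  (forall s a n t, trans Mh s (a, n) t -> n <= N) -> LEE C0.
Proof.
intros Hfin HN; split; [exact Hfin |].
destruct Hfin as [l Hl].
(* One round per label: after round [k] only entry labels above [k] remain. With [k] equal to [N]
   every remaining transition is a body transition, and (W1) concludes. *)
assert (Hk : forall k, exists C R, clos_refl_trans _ (@elim_step S L) C0 C /\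
    residual C R /\ forall s m, R s m -> k < m).
{ induction k as [| k [C [R [Hel [HC HR]]]]].
  - exists C0, (fun s n => 1 <= n /\ states C0 s).
    split; [apply rt_refl |]; split; [exact residual_init | simpl; lia].
  - destruct (@eliminate_level (1 + k) l ltac:(lia) C R HC) as [C' [R' [Hel' HC']]].
    { intros s m H; pose proof (HR s m H).
      destruct (Nat.eq_dec m (1 + k)); [right; split; [assumption |] | left; lia].
      apply Hl; destruct HC as [_ [_ [_ HC4]]]; exact (HC4 s m H). }
    exists C', R'; split; [apply rt_trans with C; assumption | exact HC']. }
destruct (Hk N) as [C [R [Hel [[HC1 _] HR]]]].
exists C; split; [exact Hel |].
intros [p Hp]; destruct witness as [_ [_ [W1 _]]]; apply W1; exists p.
intros i; destruct (Hp i) as [a Ha]; exists a.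
destruct (HC1 _ _ _ Ha) as [n [Hn [-> | H]]]; [exact Hn |].
pose proof (HN _ _ _ _ Hn); pose proof (HR _ _ H); lia.
Qed.
End WitnessToLEE.

(** * Labeled versus unlabeled transitions, and inversion of the rules *)

Section Interpretation.
Variable A : Type.
Implicit Types (e f : stexp A) (E F G : sstexp A).

Lemma step_hstep E x E' : step E x E' <-> exists l, hstep E (x, l) E'.
Proof.
split.
- induction 1; try destruct IHstep as [l IH];
    try (eexists; econstructor; eassumption).
  (* Iteration is the only rule with two labeled counterparts; excluded middle selects one. *)
  destruct (classic (normed_plus e)); eexists;
    [eapply hstep_star_entry | eapply hstep_star_body]; eassumption.
- intros [l H]; remember (x, l) as y eqn:Hy; revert x l Hy.
  induction H; intros ? ? [= <- <-]; solve [econstructor; eauto].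
Qed.

Lemma reach_hstep E F : reach (@hstep A) E F <-> reach (@step A) E F.
Proof.
split; induction 1 as [E F [x H] | E | E F G _ IH1 _ IH2];
  try apply rt_refl; try (eapply rt_trans; eassumption); apply rt_step.
- destruct x as [x l]; exists x; apply step_hstep; exists l; exact H.
- apply step_hstep in H as [l H]; exists (x, l); exact H.
Qed.

Lemma terminates_Ord E : terminates E -> exists e, E = Ord e.
Proof. destruct 1; eexists; reflexivity. Qed.

Lemma terminates_sprod E e :
  terminates (sprod E e) -> exists f, E = Ord f /\ terminates f /\ terminates e.
Proof. destruct E as [f | P]; simpl; intros H; inversion H; eauto. Qed.

Lemma sprod_inj E F e f : sprod E e = sprod F f -> E = F /\ e = f.
Proof. destruct E, F; simpl; intros [= -> ->]; split; reflexivity. Qed.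

(** The conclusion of [hstep_prod_l] is headed by the function [sprod], not by a constructor, so its
    case is resolved by injectivity of [sprod]. In the inversions below, the leftover case of that
    rule is refuted by splitting on [E1]. *)
Lemma hstep_sprod_inv E e x l G : hstep (sprod E e) (x, l) G ->
  (exists E', hstep E (x, l) E' /\ G = sprod E' e) \/
  (exists f k, E = Ord f /\ terminates f /\ l = 0 /\ hstep (Ord e) (x, k) G).
Proof.
intros H; remember (sprod E e) as D eqn:HD; remember (x, l) as y eqn:Hy.
destruct H; try (destruct E; discriminate HD); injection Hy as <- <-.
- apply sprod_inj in HD as [-> ->]; left; eauto.
- destruct E; [injection HD as -> -> | discriminate HD].
  right; exists e0, l0; auto.
Qed.

Lemma hstep_stack_inv E e x l G : hstep (stack E e) (x, l) G ->
  (exists E', hstep E (x, l) E' /\ G = stack E' e) \/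
  (exists f, E = Ord f /\ terminates f /\ l = 0 /\ x = None /\ G = Ord (Star e)).
Proof.
intros H; inversion H; subst; eauto 8.
destruct E1; discriminate.
Qed.

Lemma hstep_Plus_inv e f x l G : hstep (Ord (Plus e f)) (x, l) G ->
  l = 0 /\ exists k, hstep (Ord e) (x, k) G \/ hstep (Ord f) (x, k) G.
Proof.
intros H; inversion H; subst; eauto.
destruct E1; discriminate.
Qed.

Lemma hstep_Star_inv e x l G : hstep (Ord (Star e)) (x, l) G ->
  exists E' k, hstep (Ord e) (x, k) E' /\ G = stack E' e /\
    ((normed_plus e /\ l = star_height (Star e)) \/ (~ normed_plus e /\ l = 0)).
Proof.
intros H; inversion H; subst; eauto 9.
destruct E1; discriminate.
Qed.

Lemma hstep_Act_inv a x l G :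
  hstep (Ord (Act a)) (x, l) G -> x = Some a /\ l = 0 /\ G = Ord One.
Proof.
intros H; inversion H; subst; auto.
destruct E1; discriminate.
Qed.

Lemma hstep_Zero_inv x l G : ~ hstep (Ord Zero) (x, l) G.
Proof. intros H; inversion H; destruct E1; discriminate. Qed.

Lemma hstep_One_inv x l G : ~ hstep (Ord One) (x, l) G.
Proof. intros H; inversion H; destruct E1; discriminate. Qed.

Lemma hstep_Ord_proper e x l G : hstep (Ord e) (x, l) G -> exists a, x = Some a.
Proof.
intros H; remember (Ord e) as E eqn:HE; remember (x, l) as y eqn:Hy.
revert e x l HE Hy; induction H; intros d y k HE [= <- <-]; eauto; try discriminate.
destruct E1; [eauto | discriminate].
Qed.

(** * Finitely many derivatives, and uniqueness of marking labels *)

Fixpoint derivatives e : list (sstexp A) :=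
  match e with
  | Zero | One => nil
  | Act _ => Ord One :: nil
  | Plus e f => derivatives e ++ derivatives f
  | Prod e f => map (fun E => sprod E f) (derivatives e) ++ derivatives f
  | Star e => Ord (Star e) :: map (fun E => stack E e) (derivatives e)
  end.

(** The list over-approximates, in the manner of partial derivatives, what is reachable in at least
    one step; [Star e] lists itself because of the back transition. Treating [e] and its derivatives
    together gives closure in a single induction. *)
Lemma hstep_derivatives e E x l G :
  E = Ord e \/ In E (derivatives e) -> hstep E (x, l) G -> In G (derivatives e).
Proof.
revert E x l G; induction e as [| | a | e1 IH1 e2 IH2 | e1 IH1 e2 IH2 | e IH];
  intros E x l G HE H; simpl in *.
- destruct HE as [-> | []]; destruct (hstep_Zero_inv H).
- destruct HE as [-> | []]; destruct (hstep_One_inv H).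
- destruct HE as [-> | [<- | []]]; [| destruct (hstep_One_inv H)].
  apply hstep_Act_inv in H as [_ [_ ->]]; auto.
- apply in_or_app; destruct HE as [-> | HE].
  + apply hstep_Plus_inv in H as [_ [k [H | H]]]; eauto.
  + apply in_app_or in HE as [HE | HE]; eauto.
- assert (Hprod : forall E1, E1 = Ord e1 \/ In E1 (derivatives e1) ->
    hstep (sprod E1 e2) (x, l) G ->
    In G (map (fun E => sprod E e2) (derivatives e1) ++ derivatives e2)).
  { intros E1 HE1 H1; apply in_or_app.
    apply hstep_sprod_inv in H1 as [[E' [H1 ->]] | [f [k [_ [_ [_ H1]]]]]].
    - left; apply in_map with (f := fun E => sprod E e2); eauto.
    - right; eauto. }
  destruct HE as [-> | HE]; [apply (Hprod (Ord e1)); auto |].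
  apply in_app_or in HE as [HE | HE]; [| apply in_or_app; eauto].
  apply in_map_iff in HE as [E1 [<- HE1]]; eauto.
- assert (Hstar : hstep (Ord (Star e)) (x, l) G ->
    In G (map (fun E => stack E e) (derivatives e))).
  { intros H1; apply hstep_Star_inv in H1 as [E' [k [H1 [-> _]]]].
    apply in_map with (f := fun E => stack E e); eauto. }
  destruct HE as [-> | [<- | HE]]; auto.
  apply in_map_iff in HE as [E1 [<- HE1]].
  apply hstep_stack_inv in H as [[E' [H ->]] | [f [_ [_ [_ [_ ->]]]]]]; [right | left; auto].
  apply in_map with (f := fun E => stack E e); eauto.
Qed.

Lemma reach_derivatives e E :
  reach (@hstep A) (Ord e) E -> In E (Ord e :: derivatives e).
Proof.
intros H; apply clos_rt_rtn1 in H.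
induction H as [| F G [[x l] H] _ IH]; [left; reflexivity | right].
apply hstep_derivatives with (2 := H); destruct IH; auto.
Qed.

(* A stacked product counts only its left factor, so that a derivative is never
   larger than the expression it comes from. *)
Fixpoint esize e : nat :=
  match e with
  | Zero | One | Act _ => 1
  | Plus e f | Prod e f => 1 + esize e + esize f
  | Star e => 1 + esize e
  end.

Fixpoint size E : nat :=
  match E with
  | Ord e => esize e
  | Proper P => psize P
  end
with psize (P : pstexp A) : nat :=
  match P with
  | Stack E _ => 1 + size E
  | PProd P e => 1 + psize P + esize e
  end.

Lemma size_sprod E e : size (sprod E e) = 1 + size E + esize e.
Proof. destruct E; reflexivity. Qed.

Lemma hstep_size e x l G : hstep (Ord e) (x, l) G -> size G <= esize e.
Proof.
revert x l G; induction e as [| | a | e1 IH1 e2 IH2 | e1 IH1 e2 IH2 | e IH];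
  intros x l G H; simpl.
- destruct (hstep_Zero_inv H).
- destruct (hstep_One_inv H).
- apply hstep_Act_inv in H as [_ [_ ->]]; simpl; lia.
- apply hstep_Plus_inv in H as [_ [k [H | H]]];
    [apply IH1 in H | apply IH2 in H]; lia.
- apply (@hstep_sprod_inv (Ord e1)) in H as [[E' [H ->]] | [f [k [_ [_ [_ H]]]]]].
  + apply IH1 in H; rewrite size_sprod; lia.
  + apply IH2 in H; lia.
- apply hstep_Star_inv in H as [E' [k [H [-> _]]]].
  apply IH in H; simpl; lia.
Qed.

(** The delicate overlap is between the two product rules: a target [sprod E' e2] of the left rule
    is strictly larger than [e2], whereas by [hstep_size] a target of the right rule is not, so the
    two never agree. *)
Lemma hstep_label_unique E x l l' G :
  hstep E (x, l) G -> hstep E (x, l') G -> l = l'.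
Proof.
intros H; remember (x, l) as y eqn:Hy; revert x l l' Hy.
induction H; intros y k l' [= <- <-] H'.
- apply hstep_Act_inv in H'; tauto || (symmetry; tauto).
- apply hstep_Plus_inv in H' as [-> _]; reflexivity.
- apply hstep_Plus_inv in H' as [-> _]; reflexivity.
- apply hstep_sprod_inv in H' as [[E' [H' HG]] | [f [j [_ [_ [_ H']]]]]].
  + apply sprod_inj in HG as [<- _]; eauto.
  + apply hstep_size in H'; rewrite size_sprod in H'; lia.
- apply (@hstep_sprod_inv (Ord e1)) in H' as [[E' [H' ->]] | [f [j [_ [_ [-> _]]]]]].
  + apply hstep_size in H0; rewrite size_sprod in H0; lia.
  + reflexivity.
- apply hstep_Star_inv in H' as [F [j [_ [_ H']]]]; tauto || (symmetry; tauto).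
- apply hstep_Star_inv in H' as [F [j [_ [_ H']]]]; tauto || (symmetry; tauto).
- apply hstep_stack_inv in H' as [[E' [H' [= <-]]] | [f [_ [_ [_ [_ H']]]]]].
  + eauto.
  + discriminate.
- apply hstep_stack_inv in H' as [[E' [H' HG]] | [f [_ [_ [-> _]]]]];
    [discriminate | reflexivity].
Qed.

(** * Star height as a bound on marking labels *)

Fixpoint height E : nat :=
  match E with
  | Ord e => star_height e
  | Proper P => pheight P
  end
with pheight (P : pstexp A) : nat :=
  match P with
  | Stack E e => Nat.max (height E) (1 + star_height e)
  | PProd P e => Nat.max (pheight P) (star_height e)
  end.

Lemma height_sprod E e : height (sprod E e) = Nat.max (height E) (star_height e).
Proof. destruct E; reflexivity. Qed.

(** A stacked product counts the iteration on its right, so neither unfolding an iteration nor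
    stepping back to it raises the height. *)
Lemma hstep_height E x l G : hstep E (x, l) G -> l <= height E /\ height G <= height E.
Proof.
intros H; remember (x, l) as y eqn:Hy; revert x l Hy.
induction H; intros y k [= <- <-]; try specialize (IHhstep _ _ eq_refl);
  rewrite ?height_sprod; simpl in *; lia.
Qed.

Lemma reach_height E F : reach (@hstep A) E F -> height F <= height E.
Proof.
induction 1 as [E F [[x l] H] | E | E F G _ IH1 _ IH2]; [| lia | lia].
apply (hstep_height H).
Qed.

(** * Normedness, and termination along body transitions *)

Inductive normed : sstexp A -> Prop :=
| normed_term E : terminates E -> normed E
| normed_step E x l E' : hstep E (x, l) E' -> normed E' -> normed E.

Inductive body_normed : sstexp A -> Prop :=
| body_normed_term E : terminates E -> body_normed E
| body_normed_step E x E' : hstep E (x, 0) E' -> body_normed E' -> body_normed E.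

(** Together with [normed_plus_elim] this replaces induced steps by single transitions: the first
    transition of a star expression is always proper, and [normed] then takes transitions of either
    sort, possibly none. *)
Lemma normed_plus_intro e x l E :
  hstep (Ord e) (x, l) E -> normed E -> normed_plus e.
Proof.
(* A path to termination either consists of 1-transitions only or contains a proper action; in the
   latter case leading 1-transitions are absorbed into the first induced step. *)
assert (Hn : forall E, normed E -> terminates1 E \/ normed_plus E).
{ induction 1 as [F HF | F y k F' HF _ IH].
  - left; exists F; split; [apply rt_refl | exact HF].
  - assert (Hs : step F y F') by (apply step_hstep; eauto).
    destruct y as [a |].
    + right; destruct IH as [IH | [G [HG Ht]]].
      * exists F'; split; [| exact IH].
        apply t_step; exists a, F; split; [apply rt_refl | exact Hs].
      * exists G; split; [| exact Ht]; apply t_trans with F'; [| exact HG].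
        apply t_step; exists a, F; split; [apply rt_refl | exact Hs].
    + destruct IH as [[G [HG Ht]] | [G [HG Ht]]]; [left | right].
      * exists G; split; [| exact Ht]; apply rt_trans with F'; [apply rt_step; exact Hs | exact HG].
      * exists G; split; [| exact Ht]; apply clos_trans_t1n in HG.
        destruct HG as [G [a [D [HD HG]]] | D' G [a [D [HD HG]]] HG'].
        -- apply t_step; exists a, D; split; [| exact HG].
           apply rt_trans with F'; [apply rt_step; exact Hs | exact HD].
        -- apply t_trans with D'; [| apply clos_t1n_trans; exact HG'].
           apply t_step; exists a, D; split; [| exact HG].
           apply rt_trans with F'; [apply rt_step; exact Hs | exact HD]. }
intros H HE; destruct (hstep_Ord_proper H) as [a ->].
assert (Hs : induced_step (Ord e) a E).
{ exists (Ord e); split; [apply rt_refl | apply step_hstep; eauto]. }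
destruct (Hn E HE) as [Ht | [G [HG Ht]]].
- exists E; split; [apply t_step; exists a; exact Hs | exact Ht].
- exists G; split; [| exact Ht].
  apply t_trans with E; [apply t_step; exists a; exact Hs | exact HG].
Qed.

Lemma normed_one_steps E F : one_steps E F -> normed F -> normed E.
Proof.
induction 1 as [E F H | E | E F G _ IH1 _ IH2]; auto.
apply step_hstep in H as [l H]; eauto using normed_step.
Qed.

Lemma normed_plus_elim e :
  normed_plus e -> exists x l E, hstep (Ord e) (x, l) E /\ normed E.
Proof.
intros [G [HG [D [HD Ht]]]].
assert (HnG : normed G) by (eapply normed_one_steps; eauto using normed_term).
assert (Hind : forall E a F, induced_step E a F -> normed F ->
    exists x l E', hstep E (x, l) E' /\ normed E').
{ intros E a F [Et [H1 H2]] HF; apply step_hstep in H2 as [l H2].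
  apply clos_rt_rt1n in H1; destruct H1 as [| E1 E2 H1 H3]; [eauto |].
  apply step_hstep in H1 as [l1 H1]; exists None, l1, E1; split; [exact H1 |].
  apply clos_rt1n_rt in H3; eauto using normed_one_steps, normed_step. }
apply clos_trans_t1n in HG; revert HG; generalize (Ord e); intros D' HG.
induction HG as [E F [a H] | E F F' [a H] _ IH]; [eauto |].
destruct (IH HD HnG) as [x [l [E' [H1 H2]]]]; eauto using normed_step.
Qed.

Lemma normed_sprod E e : normed (sprod E e) -> normed E /\ normed (Ord e).
Proof.
intros H; remember (sprod E e) as D eqn:HD; revert E HD.
induction H as [D HD | D x l G HG HnG IH]; intros E ->.
- apply terminates_sprod in HD as [f [-> [H1 H2]]]; auto using normed_term.
- apply hstep_sprod_inv in HG as [[E' [H ->]] | [f [k [-> [Hf [_ H]]]]]].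
  + destruct (IH E' eq_refl); eauto using normed_step.
  + eauto using normed_term, normed_step.
Qed.

Lemma normed_stack E e : normed (stack E e) -> normed E.
Proof.
intros H; remember (stack E e) as D eqn:HD; revert E HD.
induction H as [D HD | D x l G HG HnG IH]; intros E ->.
- inversion HD.
- apply hstep_stack_inv in HG as [[E' [H ->]] | [f [-> [Hf _]]]];
    eauto using normed_term, normed_step.
Qed.

(** Once the left factor terminates, the first transition of [e] becomes a body transition of the
    product whatever its own label, because [hstep_prod_r] resets it to 0. From then on a derivative
    of [e] is at hand. *)
Lemma body_normed_sprod E e : body_normed E -> normed (Ord e) ->
  (forall G, In G (derivatives e) -> normed G -> body_normed G) ->
  body_normed (sprod E e).
Proof.
intros HE He IH; induction HE as [E HE | E x E' H _ IHE].
- destruct (terminates_Ord HE) as [f ->].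
  inversion He as [D HD | D x l G HG HnG]; subst.
  + apply body_normed_term, term_prod; assumption.
  + destruct (hstep_Ord_proper HG) as [a ->].
    apply body_normed_step with (Some a) G; [eapply hstep_prod_r; eassumption |].
    apply IH; [| exact HnG].
    apply hstep_derivatives with (2 := HG); auto.
- apply body_normed_step with (2 := IHE) (x := x), hstep_prod_l, H.
Qed.

Lemma body_normed_stack E e : body_normed E -> body_normed (stack E e).
Proof.
induction 1 as [E HE | E x E' H _ IH].
- destruct (terminates_Ord HE) as [f ->].
  apply body_normed_step with None (Ord (Star e)); [apply hstep_back, HE |].
  apply body_normed_term, term_star.
- apply body_normed_step with (2 := IH) (x := x), hstep_stack, H.
Qed.

Lemma normed_body_normed e E : In E (derivatives e) -> normed E -> body_normed E.
Proof.
revert E; induction e as [| | a | e1 IH1 e2 IH2 | e1 IH1 e2 IH2 | e IH];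
  simpl; intros E HE Hn.
- destruct HE.
- destruct HE.
- destruct HE as [<- | []]; apply body_normed_term, term_one.
- apply in_app_or in HE as [HE | HE]; auto.
- apply in_app_or in HE as [HE | HE]; [| auto].
  apply in_map_iff in HE as [F [<- HF]].
  apply normed_sprod in Hn as [Hn1 Hn2]; auto using body_normed_sprod.
- destruct HE as [<- | HE]; [apply body_normed_term, term_star |].
  apply in_map_iff in HE as [F [<- HF]].
  apply normed_stack in Hn; auto using body_normed_stack.
Qed.

(** * Well-foundedness of body transitions *)

Definition body_step E F : Prop := exists x, hstep E (x, 0) F.

Definition body_terminating E : Prop := Acc (fun F G => body_step G F) E.

Lemma body_terminating_sprod E e : body_terminating E ->
  (forall G, In G (derivatives e) -> body_terminating G) ->
  body_terminating (sprod E e).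
Proof.
intros HE He; induction HE as [E _ IH]; constructor; intros G [x H].
apply hstep_sprod_inv in H as [[E' [H ->]] | [f [k [_ [_ [_ H]]]]]].
- apply IH; exists x; exact H.
- apply He, hstep_derivatives with (2 := H); auto.
Qed.

(** The back transition fires only after [E] has reached termination, so [Star e] matters only for
    normed [E]; this guard is inherited by successors of [E]. *)
Lemma body_terminating_stack E e : body_terminating E ->
  (normed E -> body_terminating (Ord (Star e))) -> body_terminating (stack E e).
Proof.
intros HE; induction HE as [E _ IH]; intros He; constructor; intros G [x H].
apply hstep_stack_inv in H as [[E' [H ->]] | [f [-> [Hf [_ [_ ->]]]]]].
- apply IH; [exists x; exact H |].
  intros HE'; exact (He (normed_step H HE')).
- exact (He (normed_term Hf)).
Qed.

Lemma body_terminating_derivatives e E :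
  In E (Ord e :: derivatives e) -> body_terminating E.
Proof.
assert (Hder : forall E, In E (derivatives e) -> body_terminating E).
{ induction e as [| | a | e1 IH1 e2 IH2 | e1 IH1 e2 IH2 | f IH]; simpl; intros F HF.
  - destruct HF.
  - destruct HF.
  - destruct HF as [<- | []]; constructor; intros G [x H]; destruct (hstep_One_inv H).
  - apply in_app_or in HF as [HF | HF]; auto.
  - apply in_app_or in HF as [HF | HF]; [| auto].
    apply in_map_iff in HF as [F' [<- HF]]; auto using body_terminating_sprod.
  (* If [f] is normed, the unfolding is an entry and [Star f] has no body transition. Otherwise no
     successor of [f] is normed, and the guard of [body_terminating_stack] holds vacuously, which
     avoids circularity. *)
  - assert (Hstar : body_terminating (Ord (Star f))).
    { constructor; intros G [x H].
      apply hstep_Star_inv in H as [E' [k [H [-> [[_ Hl] | [Hnn _]]]]]]; [discriminate |].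
      apply body_terminating_stack.
      - apply IH, hstep_derivatives with (2 := H); auto.
      - intros HE'; destruct Hnn; exact (normed_plus_intro H HE'). }
    destruct HF as [<- | HF]; [exact Hstar |].
    apply in_map_iff in HF as [F' [<- HF]]; auto using body_terminating_stack. }
intros [<- | HE]; [| auto].
constructor; intros G [x H]; apply Hder, hstep_derivatives with (2 := H); auto.
Qed.

(** * Contexts, and the subcharts generated by entry transitions *)

Inductive frame : Type := FProd (e : stexp A) | FStack (e : stexp A).

Definition plug (k : frame) E : sstexp A :=
  match k with FProd e => sprod E e | FStack e => stack E e end.

Definition fill (K : list frame) E : sstexp A := fold_right plug E K.

Lemma fill_inj K E F : fill K E = fill K F -> E = F.
Proof.
induction K as [| [e | e] K IH]; simpl; intros H; auto; apply IH.
- apply sprod_inj in H; tauto.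
- injection H; auto.
Qed.

Lemma fill_Proper K P : exists Q, fill K (Proper P) = Proper Q.
Proof.
induction K as [| [e | e] K [Q HQ]]; simpl; rewrite ?HQ; eexists; reflexivity.
Qed.

Lemma hstep_fill K E x l F : hstep E (x, l) F -> hstep (fill K E) (x, l) (fill K F).
Proof.
intros H; induction K as [| [e | e] K IH]; simpl; auto using hstep_prod_l, hstep_stack.
Qed.

(** A transition can leave the context only by [hstep_prod_r] or [hstep_back]. Both have label 0 and
    require a star expression on the left, which the side condition excludes. *)
Lemma hstep_fill_inv K E x l G : hstep (fill K E) (x, l) G ->
  1 <= l \/ (exists P, E = Proper P) -> exists F, hstep E (x, l) F /\ G = fill K F.
Proof.
intros H HE; revert G H; induction K as [| k K IH]; simpl; intros G H; [eauto |].
assert (Hno : forall f, fill K E = Ord f -> l = 0 -> False).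
{ intros f Hf Hl; destruct HE as [HE | [P ->]]; [lia |].
  destruct (fill_Proper K P); congruence. }
assert (Hin : exists E', hstep (fill K E) (x, l) E' /\ G = plug k E').
{ destruct k as [e | e].
  - apply hstep_sprod_inv in H as [H | [f [j [Hf [_ [Hl _]]]]]]; [exact H |].
    destruct (Hno f Hf Hl).
  - apply hstep_stack_inv in H as [H | [f [Hf [_ [Hl _]]]]]; [exact H |].
    destruct (Hno f Hf Hl). }
destruct Hin as [E' [H' ->]]; destruct (IH E' H') as [F [HF ->]]; eauto.
Qed.

Lemma hstep_entry E x l G : hstep E (x, l) G -> 1 <= l ->
  exists K e, E = fill K (Ord (Star e)).
Proof.
intros H; remember (x, l) as y eqn:Hy; revert x l Hy.
induction H; intros y k [= <- <-] Hk; try lia.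
- destruct (IHhstep _ _ eq_refl Hk) as [K [e ->]]; exists (FProd e2 :: K), e; reflexivity.
- exists nil, e; reflexivity.
- destruct (IHhstep _ _ eq_refl Hk) as [K [e ->]]; exists (FStack e2 :: K), e; reflexivity.
Qed.

Section EntrySubchart.
Variables (e0 e : stexp A) (K : list frame) (n : nat).
Let Mh := labeled_one_chart_interp e0.
Let s := fill K (Ord (Star e)).
Hypothesis Hn : 1 <= n.
Hypothesis Hd : departs Mh s n.

Lemma entry_trans x G : trans Mh s (x, n) G -> normed_plus e /\ n = 1 + star_height e /\
  exists F l, hstep (Ord e) (x, l) F /\ G = fill K (stack F e).
Proof.
intros [_ H]; apply hstep_fill_inv in H as [F [H ->]]; [| auto].
apply hstep_Star_inv in H as [E' [k [H [-> [[H1 H2] | [_ H2]]]]]]; [| lia].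
split; [exact H1 |]; split; [exact H2 |]; eauto.
Qed.

Lemma fill_stack_neq F : fill K (stack F e) <> s.
Proof. intros H; apply fill_inj in H; discriminate. Qed.

(** From [fill K (stack F e)] either [F] moves or the back transition restores [s], where generation
    halts; the context [K] is never left. *)
Lemma entry_states t : states (entry_subchart Mh s n) t ->
  t = s \/ exists F, t = fill K (stack F e) /\ reach (@hstep A) (Ord e) F.
Proof.
intros [-> | H]; [left; reflexivity |].
induction H as [x t H | t x t' _ IH Hts H].
- apply entry_trans in H as [_ [_ [F [l [H ->]]]]].
  right; exists F; split; [reflexivity | apply rt_step; exists (x, l); exact H].
- destruct IH as [-> | [F [-> HF]]]; [contradiction |].
  destruct H as [_ H]; apply hstep_fill_inv in H as [G [H ->]]; [| right; eexists; reflexivity].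
  apply hstep_stack_inv in H as [[F' [H ->]] | [f [_ [_ [_ [_ ->]]]]]]; [right | left; reflexivity].
  exists F'; split; [reflexivity |].
  apply rt_trans with F; [exact HF | apply rt_step; exists (x, 0); exact H].
Qed.

Lemma entry_states_reach t : states (entry_subchart Mh s n) t -> states Mh t.
Proof.
destruct Hd as [x [t0 H0]].
intros [-> | [x' t' H | t' x' t'' _ _ H]];
  [exact (trans_src H0) | exact (trans_tgt H) | exact (trans_tgt H)].
Qed.

Lemma entry_infinite_path :
  exists p, p 0 = s /\ infinite_path (edge (entry_subchart Mh s n)) p.
Proof.
(* The invariant keeps a return route open: a body-normed [F] either terminates, so that the back
   transition leads to [s], or has a body-normed body successor; from [s], normedness of [e]
   supplies such an [F] again. *)
apply infinite_path_exists with (Q := fun t => t = s \/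
  exists F, body_normed F /\ t = fill K (stack F e) /\ states (entry_subchart Mh s n) t);
  [| left; reflexivity].
assert (Hs : reach (@hstep A) (Ord e0) s) by (destruct Hd as [x [t0 [H0 _]]]; exact H0).
intros t [-> | [F [HF [-> Ht]]]].
- destruct Hd as [x0 [t0 H0]]; apply entry_trans in H0 as [Hnp [Hne _]].
  destruct (normed_plus_elim Hnp) as [x [l [F [H HF]]]].
  destruct (hstep_Ord_proper H) as [a ->].
  assert (HU : trans Mh s (Some a, n) (fill K (stack F e))).
  { split; [exact Hs |]; apply hstep_fill; rewrite Hne.
    exact (hstep_star_entry H Hnp). }
  exists (fill K (stack F e)); split.
  + right; exists F; split; [| split; [reflexivity |]].
    * apply normed_body_normed with e; [| exact HF].
      apply hstep_derivatives with (2 := H); auto.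
    * right; apply on_path_first with (Some a); exact HU.
  + exists (Some a); left; split; [reflexivity | exact HU].
- assert (Hp := Ht); destruct Hp as [Hp | Hp]; [destruct (fill_stack_neq Hp) |].
  assert (Hreach := entry_states_reach Ht).
  destruct HF as [F HF | F x F' H HF'].
  + destruct (terminates_Ord HF) as [f ->].
    exists s; split; [left; reflexivity |].
    exists None; right; split; [exact Hp |]; split; [apply fill_stack_neq |].
    split; [exact Hreach | apply hstep_fill, hstep_back, HF].
  + assert (HB : trans Mh (fill K (stack F e)) (x, 0) (fill K (stack F' e))).
    { split; [exact Hreach | apply hstep_fill, hstep_stack, H]. }
    exists (fill K (stack F' e)); split.
    * right; exists F'; split; [exact HF' |]; split; [reflexivity |].
      right; exact (on_path_next Hp (@fill_stack_neq F) HB).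
    * exists x; right; split; [exact Hp |]; split; [apply fill_stack_neq | exact HB].
Qed.

Lemma entry_loop_chart : loop_chart (entry_subchart Mh s n).
Proof.
split; [| split; [exact entry_infinite_path | split]].
- exists (Ord e0 :: derivatives e0).
  intros t Ht; apply reach_derivatives, entry_states_reach, Ht.
- intros p Hp0 Hp; apply NNPP; intros Hno.
  assert (H1 : states Mh (p 1)).
  { destruct (Hp 0) as [x Hx]; apply entry_states_reach; exact (trans_tgt Hx). }
  apply reach_derivatives, body_terminating_derivatives in H1.
  (* The path is shifted by one because its first transition is the entry; without a return to [s],
     all later ones are body transitions. *)
  apply (Acc_no_infinite_path H1 (p := fun i => p (i + 1))); [reflexivity |].
  intros i; destruct (Hp (i + 1)) as [x [[Hs _] | [_ [_ [_ H]]]]].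
  + destruct Hno; exists (i + 1); split; [lia | exact Hs].
  + exists x; exact H.
(* (L3): all states other than [s] contain a stacked product, and no termination rule applies to
   those. *)
- intros t [Ht [_ Htm]]; destruct (entry_states Ht) as [-> | [F [-> _]]]; [reflexivity |].
  destruct (fill_Proper K (Stack F e)) as [Q HQ]; unfold stack in Htm.
  rewrite HQ in Htm; inversion Htm.
Qed.

Lemma entry_label_lt t m : states (entry_subchart Mh s n) t -> t <> s ->
  1 <= m -> departs Mh t m -> m < n.
Proof.
intros Ht Hts Hm [x [G [_ H]]].
destruct Hd as [x0 [t0 H0]]; apply entry_trans in H0 as [_ [Hne _]].
destruct (entry_states Ht) as [-> | [F [-> HF]]]; [contradiction |].
apply hstep_fill_inv in H as [G' [H _]]; [| auto].
apply hstep_stack_inv in H as [[F' [H _]] | [f [_ [_ [-> _]]]]]; [| lia].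
apply hstep_height in H as [H _]; apply reach_height in HF; simpl in HF; lia.
Qed.
End EntrySubchart.

(** * The LLEE-witness and the property LEE for the interpretation *)

Lemma interp_LLEE_witness e :
  chart_LLEE_witness (labeled_one_chart_interp e) (one_chart_interp e).
Proof.
split; [reflexivity |]; split; [| split; [| split]].
- split; [| split; [| split]]; simpl.
  + intros E; apply reach_hstep.
  + intros E; rewrite reach_hstep; reflexivity.
  + intros E x n F [HE H]; split; [apply reach_hstep, HE | apply step_hstep; eauto].
  + intros E x F [HE H]; apply step_hstep in H as [l H].
    exists l; split; [split; [apply reach_hstep, HE | exact H] |].
    intros l' [_ H']; exact (hstep_label_unique H H').
- intros [p Hp]; assert (H0 : In (p 0) (Ord e :: derivatives e)).
  { destruct (Hp 0) as [x [H _]]; exact (reach_derivatives H). }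
  apply body_terminating_derivatives in H0.
  apply (Acc_no_infinite_path H0 eq_refl).
  intros i; destruct (Hp i) as [x [_ H]]; exists x; exact H.
- intros E n Hn Hd; assert (Hd' := Hd); destruct Hd' as [x [F [_ H]]].
  destruct (hstep_entry H Hn) as [K [f ->]]; exact (entry_loop_chart Hn Hd).
- intros E n Hn Hd; assert (Hd' := Hd); destruct Hd' as [x [F [_ H]]].
  destruct (hstep_entry H Hn) as [K [f ->]]; exact (entry_label_lt Hn Hd).
Qed.

End Interpretation.

Theorem theorem5p14 (A : Type) :
  (forall e : stexp A, chart_LLEE_witness (labeled_one_chart_interp e) (one_chart_interp e)) /\
  (forall e : stexp A, LEE (one_chart_interp e)).
Proof.
split; intros e; [exact (interp_LLEE_witness e) |].
(* A label is at most the height of its source, and heights do not grow along paths from [e], so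
   [star_height e] bounds all labels. *)
apply (LLEE_witness_LEE (interp_LLEE_witness e)) with (star_height e).
- exists (Ord e :: derivatives e); intros E HE.
  apply reach_derivatives, reach_hstep, HE.
- intros E x n F [HE H].
  apply hstep_height in H as [H _]; apply reach_height in HE; simpl in HE; lia.
Qed.
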